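(* Let $\hat\theta:\mathcal{X}^n\times\mathbb{R}_+^n\to\mathbb{R}$ be a given (centrally or locally differentially private) estimator. A central or local private data acquisition mechanism $(\hat\theta,\boldsymbol\varepsilon,\mathbf{t})$ satisfies incentive compatibility $$\mathrm{COST}_i(c_i,c_i)\le \mathrm{COST}_i(c_i',c_i)\quad\text{for all } i\in\mathcal{N},\ c_i,c_i'\in\mathbb{R}_+,$$ and individual rationality $$\mathrm{COST}_i(c_i,c_i)\le \mathrm{VAR}\quad\text{for all } i\in\mathcal{N},\ c_i\in\mathbb{R}_+,$$ if and only if, for every $i\in\mathcal{N}$, the interim privacy loss $\bar\varepsilon_i(z)$ is non-increasing in $z$ and there is a constant $d_i\ge 0$ such that for all $c_i\in\mathbb{R}_+$ $$\bar t_i(c_i)=\mathbb{E}_{\mathbf{c}_{-i}}\left[\mathrm{MSE}(c_i,\mathbf{c}_{-i};\boldsymbol\varepsilon,\hat\theta)\right]-\mathrm{VAR}+c_i\bar\varepsilon_i(c_i)+\int_{c_i}^{\infty}\bar\varepsilon_i(z)\,dz+d_i .$$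
   Context: Setting. $\mathcal{N}=\{1,\dots,n\}$ is a set of users and $\theta\in\mathbb{R}$ is an unknown parameter. User $i$ holds data $X_i=\theta+Z_i\in\mathcal{X}$, where $Z_1,\dots,Z_n$ are i.i.d. with mean zero, variance $\mathrm{VAR}$, and $|Z_i|\le\frac12$. User $i$ has a privately known privacy sensitivity $c_i\in\mathbb{R}_+=[0,\infty)$, drawn independently across users (and independently of the data) from a known distribution with CDF $F_i$ and density $f_i$. Write $\mathbf{c}=(c_1,\dots,c_n)$ and $\mathbf{c}_{-i}=(c_j)_{j\ne i}$. Users report sensitivities but cannot misreport data. A private data acquisition mechanism $(\hat\theta,\boldsymbol\varepsilon,\mathbf{t})$ consists of: an estimator $\hat\theta(\mathbf{x},\boldsymbol\varepsilon)$ such that, for each privacy loss vector $\boldsymbol\varepsilon\in\mathbb{R}_+^n$, $\hat\theta(\cdot,\boldsymbol\varepsilon)$ is a randomized estimator that is $\boldsymbol\varepsilon$-differentially private in the central or local sense; privacy loss functions $\varepsilon_i:\mathbb{R}_+^n\to\mathbb{R}_+$, $\mathbf{c}\mapsto\varepsilon_i(\mathbf{c})$; and payment functions $t_i:\mathbb{R}_+^n\to\mathbb{R}_+$, $\mathbf{c}\mapsto t_i(\mathbf{c})$. These functions are assumed differentiable with Riemann integrable derivatives, and all expectations below are assumed finite. Central $\boldsymbol\varepsilon$-differential privacy: for every $i$, datasets $\mathcal{S},\mathcal{S}'$ differing only in component $i$, and measurable $\mathcal{W}\subseteq\mathbb{R}$, $\mathbb{P}(\mathcal{A}(\mathcal{S})\in\mathcal{W})\le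 e^{\varepsilon_i}\mathbb{P}(\mathcal{A}(\mathcal{S}')\in\mathcal{W})$. Local $\boldsymbol\varepsilon$-differential privacy: the estimator depends on the data only through $(\mathcal{C}_i(x_i))_i$, where $\mathcal{C}_i$ are independent randomized channels with $\mathbb{P}(\mathcal{C}_i(x)\in\mathcal{W})\le e^{\varepsilon_i}\mathbb{P}(\mathcal{C}_i(x')\in\mathcal{W})$ for all $x,x'\in\mathcal{X}$ and measurable $\mathcal{W}$. $\mathrm{MSE}(\mathbf{c};\boldsymbol\varepsilon,\hat\theta)=\mathbb{E}_{\mathbf{x}}\left[|\hat\theta(\mathbf{x},\boldsymbol\varepsilon(\mathbf{c}))-\theta|^2\right]$ (expectation over data and estimator randomness) for reported sensitivities $\mathbf{c}$. The cost of user $i$ with true sensitivity $c_i$ reporting $c_i'$, when others report truthfully, is $$\mathrm{COST}_i(c_i',c_i)=\mathbb{E}_{\mathbf{c}_{-i}}\left[\mathrm{MSE}(c_i',\mathbf{c}_{-i};\boldsymbol\varepsilon,\hat\theta)+c_i\,\varepsilon_i(c_i',\mathbf{c}_{-i})-t_i(c_i',\mathbf{c}_{-i})\right].$$ Interim quantities: $\bar t_i(c_i)=\mathbb{E}_{\mathbf{c}_{-i}}[t_i(c_i,\mathbf{c}_{-i})]$ and $\bar\varepsilon_i(c_i)=\mathbb{E}_{\mathbf{c}_{-i}}[\varepsilon_i(c_i,\mathbf{c}_{-i})]$. *)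

(* Defs.v *)
From HB Require Import structures.
From mathcomp Require Import all_boot all_order all_algebra.
From mathcomp Require Import all_classical all_reals all_analysis.

Set Implicit Arguments.
Unset Strict Implicit.
Unset Printing Implicit Defensive.

Import Order.TTheory GRing.Theory Num.Theory.
Import numFieldNormedType.Exports.

Local Open Scope classical_set_scope.
Local Open Scope ring_scope.

Definition orthant (R : realType) (n : nat) : set 'rV[R]_n :=
  [set c | forall j, 0 <= c 0 j].

(* [upd i z c] is the vector (z, c_{-i}). *)
Definition upd (R : realType) (n : nat) (i : 'I_n) (z : R) (c : 'rV[R]_n) :
  'rV[R]_n := \row_j (if j == i then z else c 0 j).

Definition mutually_independent d (T : measurableType d) (R : realType)
    (P : probability T R) (I : finType) (X : I -> {RV P >-> R}) : Prop :=
  forall A : I -> set R, (forall i, measurable (A i)) ->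
    P (\bigcap_(i in [set: I]) (X i @^-1` A i))
    = (\prod_(i : I) P (X i @^-1` A i))%E.

Definition identically_distributed d (T : measurableType d) (R : realType)
    (P : probability T R) (I : finType) (X : I -> {RV P >-> R}) : Prop :=
  forall i j (A : set R), measurable A ->
    distribution P (X i) A = distribution P (X j) A.

(* The law of X has CDF F and density f with respect to Lebesgue measure. *)
Definition has_cdf_and_density d (T : measurableType d) (R : realType)
    (P : probability T R) (X : {RV P >-> R}) (F f : R -> R) : Prop :=
  [/\ forall r, cdf X r = (F r)%:E,
      measurable_fun [set: R] f,
      forall r, 0 <= f r &
      forall A : set R, measurable A ->
        distribution P X A = (\int[lebesgue_measure]_(r in A) (f r)%:E)%E].

(* For a fixed privacy loss vector, a randomized estimator is a Markov kernel
   from datasets to R. Kernels are total on R^n; only their values on the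
   datasets with all entries in the data space XX are ever constrained. *)
Definition estimator (R : realType) (n : nat) : Type :=
  R.-pker (n.-tuple R) ~> R.

Definition dataset_in (R : realType) (n : nat) (XX : set R) (x : n.-tuple R) :
  Prop := forall i, XX (tnth x i).

Definition central_dp (R : realType) (n : nat) (XX : set R) (e : 'rV[R]_n)
    (A : estimator R n) : Prop :=
  forall (i : 'I_n) (x x' : n.-tuple R),
    dataset_in XX x -> dataset_in XX x' ->
    (forall j, j != i -> tnth x j = tnth x' j) ->
    forall W : set R, measurable W ->
      (A x W <= (expR (e 0 i))%:E * A x' W)%E.

(* The channels share one output space Y, which may be taken to be the disjoint
   union of the individual ones. Independence of the channels means that the
   joint law [mu x] of their outputs is the product law; the estimate is then
   drawn from these outputs alone, through a possibly randomized decoder. *)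
Definition local_dp (R : realType) (n : nat) (XX : set R) (e : 'rV[R]_n)
    (A : estimator R n) : Prop :=
  exists (d : measure_display) (Y : measurableType d)
         (chan : 'I_n -> R.-pker R ~> Y)
         (mu : n.-tuple R -> probability (n.-tuple Y) R)
         (dec : R.-pker (n.-tuple Y) ~> R),
    [/\ forall (i : 'I_n) (x x' : R), XX x -> XX x' ->
          forall W : set Y, measurable W ->
            (chan i x W <= (expR (e 0 i))%:E * chan i x' W)%E,
        forall x : n.-tuple R, dataset_in XX x ->
          forall B : 'I_n -> set Y, (forall i, measurable (B i)) ->
            mu x [set y | forall i, B i (tnth y i)]
            = (\prod_(i < n) chan i (tnth x i) (B i))%E &
        forall x : n.-tuple R, dataset_in XX x ->
          forall W : set R, measurable W ->
            A x W = (\int[mu x]_y dec y W)%E].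

(* Existence of the (proper) Riemann integral of g over [a, b]: the Riemann
   sums over tagged partitions a = p_0 < p_1 < ... < p_m = b, with p = a :: s,
   converge as the mesh tends to 0. *)
Definition riemann_integrable (R : realType) (g : R -> R) (a b : R) : Prop :=
  exists I : R, forall eta : R, 0 < eta -> exists2 delta : R, 0 < delta &
    forall (s : seq R) (xi : nat -> R), itv_partition a b s ->
      (forall k, (k < size s)%N ->
         (a :: s)`_k.+1 - (a :: s)`_k < delta /\
         (a :: s)`_k <= xi k <= (a :: s)`_k.+1) ->
      `| \sum_(k < size s) g (xi k) * ((a :: s)`_k.+1 - (a :: s)`_k) - I |
        < eta.

(* Differentiability on the closed orthant is relative to the orthant, i.e.
   one-sided in the vanishing coordinates; the gradient D is then unique there.
   Each partial derivative is Riemann integrable in its own variable. *)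
Definition differentiable_with_integrable_derivative (R : realType) (n : nat)
    (g : 'rV[R]_n -> R) : Prop :=
  exists D : 'rV[R]_n -> 'rV[R]_n,
    (forall c, orthant c -> forall eta : R, 0 < eta ->
       \forall c' \near within (@orthant R n) (nbhs c),
         `|g c' - g c - \sum_(j < n) D c 0 j * (c' 0 j - c 0 j)|
         <= eta * `|c' - c|) /\
    (forall (j : 'I_n) c (a b : R), orthant c -> 0 <= a -> a <= b ->
       riemann_integrable (fun s => D (upd j s c) 0 j) a b).

Section mechanism.
Context d (T : measurableType d) (R : realType) (P : probability T R) (n : nat).
Variables (theta : R) (Z C : 'I_n -> {RV P >-> R}).

Definition data (w : T) : n.-tuple R := [tuple theta + Z i w | i < n].

Definition sensitivities (w : T) : 'rV[R]_n := \row_i C i w.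

Definition noise_and_sensitivities (k : 'I_n + 'I_n) : {RV P >-> R} :=
  match k with inl i => Z i | inr i => C i end.

(* E_{c_{-i}} [g (z, c_{-i})] *)
Definition interim (g : 'rV[R]_n -> \bar R) (i : 'I_n) (z : R) : \bar R :=
  (\int[P]_w g (upd i z (sensitivities w)))%E.

Variables (est : 'rV[R]_n -> estimator R n).
Variables (eps t : 'rV[R]_n -> 'rV[R]_n).

Definition mse (c : 'rV[R]_n) : \bar R :=
  (\int[P]_w \int[est (eps c) (data w)]_y ((`|y - theta| ^+ 2)%:E))%E.

(* [cost i r c] is COST_i(r, c): r is the report, c the true sensitivity. *)
Definition cost (i : 'I_n) (r c : R) : \bar R :=
  interim (fun b => (mse b + (c * eps b 0 i)%:E - (t b 0 i)%:E)%E) i r.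

Definition interim_mse : 'I_n -> R -> \bar R := interim mse.

Definition interim_privacy_loss (i : 'I_n) : R -> \bar R :=
  interim (fun b => (eps b 0 i)%:E) i.

Definition interim_payment (i : 'I_n) : R -> \bar R :=
  interim (fun b => (t b 0 i)%:E) i.

Definition finite_expectations : Prop :=
  (forall c, orthant c -> mse c \is a fin_num) /\
  (forall (i : 'I_n) (z : R), 0 <= z ->
    [/\ P.-integrable setT (fun w => mse (upd i z (sensitivities w))),
        P.-integrable setT
          (fun w => (eps (upd i z (sensitivities w)) 0 i)%:E) &
        P.-integrable setT
          (fun w => (t (upd i z (sensitivities w)) 0 i)%:E)]).

Definition incentive_compatible : Prop :=
  forall (i : 'I_n) (c c' : R), 0 <= c -> 0 <= c' ->
    (cost i c c <= cost i c' c)%E.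

Definition individually_rational (VAR : R) : Prop :=
  forall (i : 'I_n) (c : R), 0 <= c -> (cost i c c <= VAR%:E)%E.

End mechanism.

(* Main.v *)
Require Import Defs.
From HB Require Import structures.
From mathcomp Require Import all_boot all_order all_algebra.
From mathcomp Require Import all_classical all_reals all_analysis.
From mathcomp Require Import measurable_realfun ring lra.
Import Order.TTheory GRing.Theory Num.Theory.
Import numFieldNormedType.Exports.
Local Open Scope classical_set_scope.
Local Open Scope ring_scope.

(** A user with true sensitivity [c] who reports [r] pays [m r - p r + c * e r],
    where [m], [e] and [p] are the interim error, privacy loss and payment.
    Incentive compatibility between two reports [a <= b] sandwiches the increment
    [h b - h a] of the truthful cost [h] between [(b - a) * e b] and
    [(b - a) * e a].  The integral of the non-increasing function [e] from [a] to [b]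
    satisfies the same bounds, and bisecting shows that these bounds determine an
    additive interval function, so [h b - h a] is that integral.  Individual
    rationality bounds [h], which makes the tail integral of [e] finite, and [di]
    is the gap between [VAR] and the limit of [h] at infinity. *)

(** * Vanishing of additive interval functions by bisection *)

Lemma dominated_by_halving (R : realType) (x y : R) :
  (forall k : nat, x <= y / 2 ^+ k) -> x <= 0.
Proof.
move=> xy.
have cvg0 : geometric y (2^-1 : R) @ \oo --> (0 : R).
  by apply: cvg_geometric; rewrite ger0_norm ?invf_lt1 ?invr_ge0 ?ltr1n.
rewrite -(cvg_lim _ cvg0)//; apply: limr_ge; first exact: cvgP cvg0.
by apply: nearW => k; rewrite /geometric /= exprVn.
Qed.

Section bisection.
Context (R : realType) (e : R -> R) (phi : R -> R -> R).
Hypothesis phi_add : forall a b c : R, 0 <= a -> a <= b -> b <= c ->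
  phi a c = phi a b + phi b c.
Hypothesis phi_bound : forall a b : R, 0 <= a -> a <= b ->
  `|phi a b| <= (b - a) * (e a - e b).

(** Cutting at the midpoint halves the length, while the drops of [e] over the two halves add up to
    [e a - e b]; so each level of bisection gains a factor 2. *)
Lemma bisection_bound (k : nat) (a b : R) : 0 <= a -> a <= b ->
  `|phi a b| <= (b - a) * (e a - e b) / 2 ^+ k.
Proof.
elim: k a b => [|k IH] a b a0 ab; first by rewrite expr0 divr1 phi_bound.
have am : a <= (a + b) / 2 by lra.
have mb : (a + b) / 2 <= b by lra.
have m0 : 0 <= (a + b) / 2 by lra.
rewrite (phi_add _ _ _ a0 am mb) (le_trans (ler_normD _ _))//.
apply: (le_trans (lerD (IH _ _ a0 am) (IH _ _ m0 mb))).
rewrite le_eqVlt; apply/orP; left; apply/eqP.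
by rewrite exprS; field; rewrite expf_neq0// pnatr_eq0.
Qed.

Lemma bisection_eq0 (a b : R) : 0 <= a -> a <= b -> phi a b = 0.
Proof.
move=> a0 ab; apply/eqP; rewrite -normr_le0.
apply: (@dominated_by_halving _ _ ((b - a) * (e a - e b))) => k.
exact: bisection_bound.
Qed.

End bisection.

(** * Integrals of a nonnegative, non-increasing function on the half-line *)

Lemma subset_itv_nonneg (R : realType) (a : R) (c : itv_bound R) :
  0 <= a -> [set` Interval (BLeft a) c] `<=` `[0, +oo[.
Proof.
move=> a0 x /=; rewrite itv_boundlr bnd_simp => /andP[ax _].
by rewrite in_itv/= andbT (le_trans a0).
Qed.

Section nonincreasing_integral.
Context (R : realType) (e : R -> R).
Hypothesis e_ge0 : forall x : R, 0 <= x -> 0 <= e x.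
Hypothesis e_ni : forall x y : R, 0 <= x -> x <= y -> e y <= e x.
Local Notation mu := (@lebesgue_measure R).

Lemma nonincreasing_nonneg_measurable (D : set R) : measurable D ->
  D `<=` `[0, +oo[ -> measurable_fun D (fun x => (e x)%:E).
Proof.
move=> mD D0; apply/measurable_EFinP.
(* Monotonicity of [e] is known only on the half-line; freezing the argument at 0 extends it to a
   function that is non-increasing on all of [R]. *)
pose f (x : R) : R := e (Num.max 0 x).
have ef : {in D, f =1 e}.
  by move=> x; rewrite inE => /D0 /=; rewrite in_itv/= andbT /f => /max_r ->.
apply: (eq_measurable_fun f ef).
apply: nonincreasing_measurable => // x y xy; apply: e_ni.
  by rewrite le_max lexx.
by rewrite ge_max !le_max lexx/= xy orbT.
Qed.

(** The right end [c] is any interval bound, so that bounded intervals and infinite tails are both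
    covered. *)
Lemma integral_nonincreasing_split (a b : R) (c : itv_bound R) :
  0 <= a -> a <= b -> (BLeft b <= c)%O ->
  (\int[mu]_(z in [set` Interval (BLeft a) c]) (e z)%:E =
   \int[mu]_(z in `[a, b[) (e z)%:E +
   \int[mu]_(z in [set` Interval (BLeft b) c]) (e z)%:E)%E.
Proof.
move=> a0 ab bc.
have sub0 : [set` Interval (BLeft a) c] `<=` `[0, +oo[.
  exact: subset_itv_nonneg.
have split := itv_bndbnd_setU _ bc.
rewrite (split (BLeft a)) ?bnd_simp// ge0_integral_setU//.
- rewrite -split ?bnd_simp//; exact: nonincreasing_nonneg_measurable.
- move=> x; rewrite -split ?bnd_simp// => /sub0/=.
  by rewrite in_itv/= andbT lee_fin; exact: e_ge0.
- apply/disj_setPS => y [/=]; rewrite in_itv/= => /andP[_ yb].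
  by rewrite itv_boundlr => /andP[]; rewrite bnd_simp leNgt yb.
Qed.

Lemma integral_nonincreasing_bounds (a b : R) : 0 <= a -> a <= b ->
  (((b - a) * e b)%:E <= \int[mu]_(z in `[a, b[) (e z)%:E <= ((b - a) * e a)%:E)%E.
Proof.
move=> a0 ab.
have intc (r : R) : (\int[mu]_(z in `[a, b[) (cst r%:E) z = ((b - a) * r)%:E)%E.
  rewrite integral_cst//= lebesgue_measure_itv/= lte_fin.
  case: ltgtP ab => // [ab _|-> _]; first by rewrite -EFinB -EFinM mulrC.
  by rewrite subrr mul0r mule0.
have me : measurable_fun `[a, b[ (fun x => (e x)%:E).
  apply: nonincreasing_nonneg_measurable => //.
  exact: subset_itv_nonneg.
have itvP x : `[a, b[%classic x -> 0 <= x /\ a <= x /\ x <= b.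
  by rewrite /= in_itv/= => /andP[ax /ltW xb]; rewrite ax xb (le_trans a0).
rewrite -!intc; apply/andP; split; apply: ge0_le_integral => //=.
- by move=> x _; rewrite lee_fin e_ge0// (le_trans a0).
- by move=> x /itvP[x0 [ax xb]]; rewrite lee_fin e_ni.
- by move=> x /itvP[x0 [ax xb]]; rewrite lee_fin e_ge0.
- by move=> x /itvP[x0 [ax xb]]; rewrite lee_fin e_ni.
Qed.

Lemma integral_nonincreasing_fin_num (a b : R) : 0 <= a -> a <= b ->
  (\int[mu]_(z in `[a, b[) (e z)%:E)%E \is a fin_num.
Proof.
move=> a0 ab; have /andP[l u] := integral_nonincreasing_bounds _ _ a0 ab.
by rewrite fin_numElt (lt_le_trans _ l) ?ltNyr// (le_lt_trans u) ?ltry.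
Qed.

(** The integral and the increment of [h] are both additive and lie between the same two bounds, so
    their difference is additive and at most [(b - a) * (e a - e b)] in absolute value: bisection
    makes it zero. *)
Lemma integral_nonincreasing_eq (h : R -> R) :
  (forall a b : R, 0 <= a -> a <= b ->
     (b - a) * e b <= h b - h a <= (b - a) * e a) ->
  forall a b, 0 <= a -> a <= b ->
    (\int[mu]_(z in `[a, b[) (e z)%:E)%E = (h b - h a)%:E.
Proof.
move=> hb a b a0 ab.
pose I x y := fine (\int[mu]_(z in `[x, y[) (e z)%:E)%E.
have EI x y : 0 <= x -> x <= y -> (\int[mu]_(z in `[x, y[) (e z)%:E)%E = (I x y)%:E.
  by move=> x0 xy; rewrite fineK// integral_nonincreasing_fin_num.
rewrite EI//; congr EFin.
suff /subr0_eq : I a b - (h b - h a) = 0 by [].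
apply: (@bisection_eq0 _ e (fun x y => I x y - (h y - h x))) => // {a b a0 ab}.
  move=> a b c a0 ab bc.
  have : (I a c)%:E = (I a b + I b c)%:E.
    rewrite EFinD -!EI ?(le_trans a0)// ?(le_trans ab)//.
    by rewrite (integral_nonincreasing_split _ _ _ a0 ab)// bnd_simp.
  by case=> ->; ring.
move=> a b a0 ab; have := hb _ _ a0 ab.
have := integral_nonincreasing_bounds _ _ a0 ab; rewrite EI// !lee_fin.
by rewrite ler_norml; lra.
Qed.

(** Monotone convergence along the truncations at [a + k]; the limit may be infinite. *)
Lemma cvg_integral_nonincreasing_tail (a : R) : 0 <= a ->
  (\int[mu]_(z in `[a, (a + k%:R)%R[) (e z)%:E)%E @[k --> \oo] -->
  (\int[mu]_(z in `[a, +oo[) (e z)%:E)%E.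
Proof.
move=> a0.
have -> : `[a, +oo[%classic = \bigcup_k `[a, a + k%:R[%classic.
  apply/seteqP; split=> x /=; rewrite in_itv/= ?andbT.
    (* The truncations are open on the right, so an integer strictly above [x - a] is taken. *)
    move=> ax; exists (Num.trunc (x - a)).+1 => //=.
    by rewrite in_itv/= ax/= -ltrBlDl truncnS_gt.
  by case=> k _ /=; rewrite in_itv/= => /andP[].
apply: ge0_nondecreasing_set_cvg_integral => //.
- apply/nondecreasing_seqP => k; rewrite subsetEset; apply: subset_itvl.
  by rewrite bnd_simp lerD2l ler_nat.
- move=> k; apply: nonincreasing_nonneg_measurable => //.
  by apply: subset_itv_nonneg.
- move=> k x /=; rewrite in_itv/= => /andP[ax _].
  by rewrite lee_fin e_ge0// (le_trans a0).
Qed.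

End nonincreasing_integral.

(** The characterization for a single user, with real interim functions. The tail integral stays in
    the extended reals, since its finiteness has to be derived in both directions. *)
Lemma incentive_compatible_rational_iff (R : realType) (m e p : R -> R) (V : R) :
  (forall x : R, 0 <= x -> 0 <= e x) ->
  ((forall c c' : R, 0 <= c -> 0 <= c' ->
      m c + c * e c - p c <= m c' + c * e c' - p c') /\
   (forall c : R, 0 <= c -> m c + c * e c - p c <= V)) <->
  ((forall z z' : R, 0 <= z -> z <= z' -> e z' <= e z) /\
   exists2 d, 0 <= d & forall c : R, 0 <= c ->
     ((p c)%:E = (m c)%:E - V%:E + c%:E * (e c)%:E +
        \int[lebesgue_measure]_(z in `[c, +oo[) (e z)%:E + d%:E)%E).
Proof.
move=> e_ge0; pose h c := m c + c * e c - p c.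
pose J c := (\int[lebesgue_measure]_(z in `[c, +oo[) (e z)%:E)%E.
split=> [[ic ir]|[e_ni [d d0 pE]]].
  have e_ni (z z' : R) : 0 <= z -> z <= z' -> e z' <= e z.
    rewrite [z <= _]le_eqVlt => z0 /predU1P[->//|zz'].
    have z'0 : 0 <= z' by rewrite (le_trans z0) ?ltW.
    (* The two constraints add up to [(z' - z) * (e z' - e z) <= 0], where [z' - z] is positive. *)
    by have := ic _ _ z0 z'0; have := ic _ _ z'0 z0; nra.
  have h_int (a b : R) : 0 <= a -> a <= b ->
      (\int[lebesgue_measure]_(z in `[a, b[) (e z)%:E)%E = (h b - h a)%:E.
    apply: integral_nonincreasing_eq => // {}a {}b a0 ab.
    have b0 : 0 <= b by rewrite (le_trans a0).
    by have := ic _ _ a0 b0; have := ic _ _ b0 a0; rewrite /h; lra.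
  (* The integral up to [k] is [h k - h 0], and rationality at [k] gives [h k <= V]; then [k] tends
     to infinity. *)
  have J_le : (J 0%R <= (V - h 0)%:E)%E.
    have tail := cvg_integral_nonincreasing_tail _ _ e_ge0 e_ni _ (lexx 0).
    rewrite /J -(cvg_lim _ tail)//; apply: lime_le; first exact: cvgP tail.
    apply: nearW => k; rewrite h_int ?add0r// lee_fin lerD2r.
    exact: ir.
  have J_fin : J 0 \is a fin_num.
    rewrite ge0_fin_numE ?(le_lt_trans J_le) ?ltry//.
    apply: integral_ge0 => x /=; rewrite in_itv/= andbT lee_fin.
    exact: e_ge0.
  (* Here [h 0 + J 0] is the limit of [h] at infinity, because [h c = h 0 + J 0 - J c]. *)
  split=> //; exists (V - h 0 - fine (J 0)).
    by rewrite subr_ge0 -lee_fin fineK.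
  move=> c c0; rewrite -/(J c).
  have J0E : J 0 = ((h c - h 0)%:E + J c)%E.
    by rewrite -h_int//; exact: integral_nonincreasing_split.
  have Jc_fin : J c \is a fin_num by move: J_fin; rewrite J0E fin_numD => /andP[].
  rewrite J0E -(fineK Jc_fin) -!(EFinN, EFinM, EFinD) /h; congr EFin => /=.
  ring.
(* An infinite tail would make the right side of [pE] infinite, but the payment is a real number. *)
have Jc_fin (c : R) : 0 <= c -> J c \is a fin_num.
  move=> /pE; rewrite -/(J c); case: (J c) => [r||]//.
have J_ge0 (c : R) : 0 <= c -> (0 <= J c)%E.
  move=> c0; apply: integral_ge0 => x /=; rewrite in_itv/= andbT lee_fin => cx.
  by rewrite e_ge0// (le_trans c0).
have hE (c : R) : 0 <= c -> h c = V - d - fine (J c).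
  move=> c0; have := pE _ c0; rewrite -/(J c) -(fineK (Jc_fin _ c0)).
  by rewrite -!(EFinN, EFinM, EFinD) /h => -[->]; rewrite /=; ring.
have h_bounds (a b : R) : 0 <= a -> a <= b ->
    (b - a) * e b <= h b - h a <= (b - a) * e a.
  move=> a0 ab; have b0 : 0 <= b by rewrite (le_trans a0).
  rewrite -!lee_fin.
  suff -> : (h b - h a)%:E = (\int[lebesgue_measure]_(z in `[a, b[) (e z)%:E)%E.
    exact: integral_nonincreasing_bounds.
  have Ifin := integral_nonincreasing_fin_num _ _ e_ge0 e_ni _ _ a0 ab.
  have : J a = (\int[lebesgue_measure]_(z in `[a, b[) (e z)%:E + J b)%E.
    exact: integral_nonincreasing_split.
  rewrite -(fineK Ifin) -(fineK (Jc_fin _ a0)) -(fineK (Jc_fin _ b0)).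
  by rewrite -EFinD !hE// => -[->]; congr EFin; ring.
split=> [c c' c0 c'0|c c0].
  (* Reporting [c'] with true sensitivity [c] costs [h c' - (c' - c) * e c']. Comparing this with
     [h c] is the lower bound of [h_bounds] when [c <= c'] and the upper one otherwise. *)
  by have [cc'|/ltW cc'] := leP c c';
    [have := h_bounds _ _ c0 cc'|have := h_bounds _ _ c'0 cc'];
    rewrite /h; lra.
rewrite -/(h c) hE//; have := J_ge0 _ c0; have := fine_ge0 (J_ge0 _ c0); lra.
Qed.

(** * Reduction of the mechanism to its interim functions *)

Theorem proposition1 (R : realType) (n : nat)
  (d : measure_display) (T : measurableType d) (P : probability T R)
  (theta VAR : R) (XX : set R)
  (Z C : 'I_n -> {RV P >-> R}) (F f : 'I_n -> R -> R)
  (Z_iid : identically_distributed Z)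
  (ZC_indep : mutually_independent (noise_and_sensitivities Z C))
  (Z_mean : forall i, ('E_P[Z i] = 0)%E)
  (Z_var : forall i, ('V_P[Z i] = VAR%:E)%E)
  (Z_bound : forall i w, `|Z i w| <= 2^-1)
  (X_in_XX : forall i w, XX (theta + Z i w))
  (C_ge0 : forall i w, 0 <= C i w)
  (C_law : forall i, has_cdf_and_density (C i) (F i) (f i))
  (est : 'rV[R]_n -> estimator R n)
  (est_dp : (forall e, orthant e -> central_dp XX e (est e)) \/
            (forall e, orthant e -> local_dp XX e (est e)))
  (eps t : 'rV[R]_n -> 'rV[R]_n)
  (eps_ge0 : forall c, orthant c -> orthant (eps c))
  (t_ge0 : forall c, orthant c -> orthant (t c))
  (eps_diff : forall i,
     differentiable_with_integrable_derivative (fun c => eps c 0 i))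
  (t_diff : forall i,
     differentiable_with_integrable_derivative (fun c => t c 0 i))
  (fin_exp : finite_expectations theta Z C est eps t) :
  (incentive_compatible theta Z C est eps t /\
   individually_rational theta Z C est eps t VAR)
  <->
  (forall i : 'I_n,
     (forall z z' : R, 0 <= z -> z <= z' ->
        (interim_privacy_loss C eps i z' <= interim_privacy_loss C eps i z)%E) /\
     (exists2 di : R, 0 <= di &
        forall ci : R, 0 <= ci ->
          (interim_payment C t i ci =
             interim_mse theta Z C est eps i ci - VAR%:E
             + ci%:E * interim_privacy_loss C eps i ci
             + \int[lebesgue_measure]_(z in `[ci, +oo[)
                 interim_privacy_loss C eps i z
             + di%:E)%E)).
Proof.
have orth i (z : R) w : 0 <= z -> orthant (upd i z (sensitivities C w)).
  by move=> z0 j; rewrite mxE; case: ifP => // _; rewrite mxE.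
have [_ int_exp] := fin_exp.
(* [fine] loses nothing at a report [z >= 0], where integrability makes all three expectations
   finite. *)
pose m i z := fine (interim_mse theta Z C est eps i z).
pose e i z := fine (interim_privacy_loss C eps i z).
pose p i z := fine (interim_payment C t i z).
have mE i (z : R) : 0 <= z -> interim_mse theta Z C est eps i z = (m i z)%:E.
  by move=> /(int_exp i)[im _ _]; rewrite fineK// integrable_fin_num.
have eE i (z : R) : 0 <= z -> interim_privacy_loss C eps i z = (e i z)%:E.
  by move=> /(int_exp i)[_ ie _]; rewrite fineK// integrable_fin_num.
have pE i (z : R) : 0 <= z -> interim_payment C t i z = (p i z)%:E.
  by move=> /(int_exp i)[_ _ ip]; rewrite fineK// integrable_fin_num.
have e_ge0 i (z : R) : 0 <= z -> 0 <= e i z.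
  move=> z0; apply/fine_ge0/integral_ge0 => w _; rewrite lee_fin.
  exact/eps_ge0/orth.
(* The true sensitivity [c] is a constant under the expectation, so the cost is affine in [c] with
   slope [e i r]. *)
have costE i (r c : R) : 0 <= r ->
    cost theta Z C est eps t i r c = (m i r + c * e i r - p i r)%:E.
  move=> r0; have [im ie ip] := int_exp i r r0.
  have ice := integrableZl measurableT c ie.
  rewrite EFinB EFinD EFinM -mE// -eE// -pE// /cost /interim.
  under eq_integral do rewrite EFinM.
  rewrite integralB//; last exact: integrableD.
  by rewrite integralD// integralZl.
have charac i := incentive_compatible_rational_iff _ (m i) (e i) (p i) VAR (e_ge0 i).
have JE i (c : R) : 0 <= c ->
    (\int[lebesgue_measure]_(z in `[c, +oo[) interim_privacy_loss C eps i z =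
     \int[lebesgue_measure]_(z in `[c, +oo[) (e i z)%:E)%E.
  move=> c0; apply: eq_integral => z; rewrite inE/= in_itv/= andbT => cz.
  by rewrite eE// (le_trans c0).
split=> [[ic ir] i|H].
- have [|e_ni [di di0 piE]] := (charac i).1.
    split=> [c c' c0 c'0|c c0]; rewrite -lee_fin.
      by have := ic i c c' c0 c'0; rewrite !costE//.
    by have := ir i c c0; rewrite costE.
  split=> [z z' z0 zz'|].
    by rewrite !eE ?(le_trans z0)// lee_fin e_ni.
  by exists di => // c c0; rewrite pE// mE// eE// JE// piE.
- split=> i; (have [|ic ir] := (charac i).2; first
    have [e_ni [di di0 piE]] := H i).
  1,3: split=> [z z' z0 zz'|];
    [by rewrite -lee_fin -!eE ?(le_trans z0)// e_ni
    |by exists di => // c c0; rewrite -pE// -mE// -eE// -JE// piE].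
  + by move=> c c' c0 c'0; rewrite !costE// lee_fin ic.
  + by move=> c c0; rewrite costE// lee_fin ir.
Qed.
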